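(* For all input domains $V$ (with $|V|\ge 2$), the protocol $\Pi_{\mathrm{atc}}^{V}$ (the asynchronous Turpin–Coan extension, defined in the context) does NOT securely implement multi-valued asynchronous Byzantine agreement from A-Cast and binary asynchronous Byzantine agreement, in the presence of a static and malicious $t$-adversary, for any $t\ge n/5$.
   Context: **Setting.** $n$ parties $p_1,\dots,p_n$ in an asynchronous network with eventual delivery: the adversary schedules messages and may delay each by an arbitrary finite amount. A static malicious $t$-adversary fixes before the execution a set of up to $t$ corrupted parties, who may behave arbitrarily. **A-Cast** (ideal primitive): a distinguished sender distributes a value; if one honest party accepts a value from the sender's A-Cast then all honest parties eventually accept the same value; if the sender is honest, all honest parties eventually accept the sender's input. (With a corrupted sender, possibly no honest party ever accepts.) The adversary controls when each party accepts each A-Cast. **Asynchronous Byzantine agreement (A-BA)** on a domain $V$: each party has an input in $V$; *agreement*: all honest parties that output, output the same value; *validity*: if all honest parties have the same input $v$, they output $v$. ''Binary'' means $V=\{0,1\}$. Because of asynchrony, inputs of up to $t$ honest parties may be delayed and not taken into account in A-BA: if the remaining $n-t$ parties (including corrupted ones) all participate with the same input, that value can be the output regardless of the delayed parties' inputs. ''Securely implements'' means that, with A-Cast and an arbitrary binary A-BA protocol (nothing is assumed about it beyond the A-BA properties) as building blocks, agreement and validity hold on $V$ for all inputs, adversaries and message schedulings; the proposition asserts that this fails. **Protocol $\Pi_{\mathrm{atc}}^{V}$**, $|V|\ge2$ (code for $p_i$ with input $v_i\in V$): 0. Initialize arrays $v[1..n]$ and $x[1..n]$ with the default value $\bot$.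 1. A-Cast $v_i$. 2. Whenever $v'_j$ is accepted from $p_j$, record $v[j]:=v'_j$. 3. Wait until $n-t$ values are accepted. Then let $x_i:=1$ (''perplexed'') if $v[j]\ne\bot$ and $v[j]\neq v_i$ for at least $t+1$ different indices $j$, and otherwise $x_i:=0$ (''content''). A-Cast $(v_i,x_i)$. 4. Whenever $(v'_j,x'_j)$ is accepted from $p_j$, record $x[j]:=x'_j$; if $v[j]=\bot$, additionally record $v[j]:=v'_j$. 5. Wait until $n-t$ pairs are accepted. Then let $a_i:=1$ (''alert'') if $x[j]=1$ for at least $t+1$ different indices $j$, and otherwise $a_i:=0$. Run binary A-BA with input $a_i$. 6. If the binary A-BA agrees on $1$, set $v$ to a predefined default value from $V$. Otherwise, if content set $v:=v_i$, and if perplexed set $v$ to the majority value among the non-$\bot$ entries $v[j]$ at indices $j$ with $x[j]=0$ (nothing is specified when no majority exists, so correctness may not rely on any tie-breaking). Output $v$. *)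

(* Defs.v *)
From mathcomp Require Import all_boot.

Set Implicit Arguments.
Unset Strict Implicit.
Unset Printing Implicit Defensive.

(* Plain MathComp.  The parties are the elements of 'I_n. *)

(** ** The primitives *)

(* Correctness of an asynchronous Byzantine agreement on a domain [W], for one
   complete run: [inp i w] says that party [i] has input [w], and [out i w]
   that [i] outputs [w] at some point of the run.  Nothing is required when
   honest inputs differ, apart from agreement. *)
Definition ABA (n : nat) (W : Type) (honest : {set 'I_n})
    (inp out : 'I_n -> W -> Prop) : Prop :=
  (* agreement *)
  (forall i j w w', i \in honest -> j \in honest ->
     out i w -> out j w' -> w = w')
  /\
  (* validity *)
  (forall w, (forall i, i \in honest -> inp i w) ->
     forall i, i \in honest -> out i w).

(* One A-Cast instance per sender, in one complete run: [sent j k m] says that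
   [j] has given [m] as input to its A-Cast by time [k], and [acc i j k m] that
   [i] accepts [m] from [j] at time [k].  [sent] is only used for honest
   senders.  The acceptance times are otherwise free. *)
Definition ACast (n : nat) (M : Type) (honest : {set 'I_n})
    (sent : 'I_n -> nat -> M -> Prop)
    (acc : 'I_n -> 'I_n -> nat -> M -> Prop) : Prop :=
  [/\ (forall i i' j k k' m m', i \in honest -> i' \in honest ->
         acc i j k m -> acc i' j k' m' -> m = m'),
      (forall i i' j k m, i \in honest -> i' \in honest ->
         acc i j k m -> exists k', acc i' j k' m),
      (forall i j k m, i \in honest -> j \in honest ->
         sent j k m -> exists k', acc i j k' m)
    & (forall i j k m, i \in honest -> j \in honest ->
         acc i j k m -> sent j k m)].

(** ** The code of a party *)

(* [accepted]: senders whose first A-Cast has been accepted;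
   [varr], [xarr]: the arrays v[1..n] and x[1..n], with None for bottom;
   [xbit]: the bit x_i (true = perplexed), None until it is computed, at which
     moment (v_i, x_i) is A-Cast;
   [abit]: the bit a_i (true = alert), None until it is computed, at which
     moment it is given as input to the binary A-BA;
   [output]: None until the party outputs. *)
Record lstate (n : nat) (V : Type) := LState {
  accepted : {set 'I_n};
  varr : 'I_n -> option V;
  xarr : 'I_n -> option bool;
  xbit : option bool;
  abit : option bool;
  output : option V
}.

(* What the network can hand to a party. *)
Inductive input_event (n : nat) (V : Type) :=
  | AcceptValue of 'I_n & V
  | AcceptPair of 'I_n & V & bool
  | BAOutput of bool.
Arguments BAOutput {n V} _.

Section Code.

Context {n : nat} {V : eqType}.
Implicit Types (s : lstate n V) (i j : 'I_n) (v : V).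

Definition step3 (t : nat) v s : lstate n V :=
  if (xbit s == None) && (n - t <= #|accepted s|) then
    LState (accepted s) (varr s) (xarr s)
      (Some (t < #|[set j | (varr s j != None) && (varr s j != Some v)]|))
      (abit s) (output s)
  else s.

Definition step5 (t : nat) s : lstate n V :=
  if [&& xbit s != None, abit s == None
       & n - t <= #|[set j | xarr s j != None]|] then
    LState (accepted s) (varr s) (xarr s) (xbit s)
      (Some (t < #|[set j | xarr s j == Some true]|))
      (output s)
  else s.

(* The waits are left as soon as their condition holds. *)
Definition progress (t : nat) v s : lstate n V := step5 t (step3 t v s).

Definition init_state (t : nat) v : lstate n V :=
  progress t v (LState set0 (fun=> None) (fun=> None) None None None).

Definition content_entries s : {set 'I_n} :=
  [set j | (xarr s j == Some false) && (varr s j != None)].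

(* Strict majority.  When there is none, the result is [tie], which a run
   leaves arbitrary. *)
Definition majority s (tie : V) : V :=
  let C := content_entries s in
  if [pick j in C | #|C| < 2 * #|[set k in C | varr s k == varr s j]|] is Some j
  then odflt tie (varr s j) else tie.

Definition decision (vdef v tie : V) s (b : bool) : V :=
  if b then vdef
  else if xbit s == Some true then majority s tie else v.

Definition handle (t : nat) (vdef v tie : V) s (e : input_event n V) :
    lstate n V :=
  match e with
  | AcceptValue j w =>
      progress t v
        (LState (j |: accepted s) [eta varr s with j |-> Some w] (xarr s)
           (xbit s) (abit s) (output s))
  | AcceptPair j w x =>
      progress t v
        (LState (accepted s)
           (if varr s j is None then [eta varr s with j |-> Some w] else varr s)
           [eta xarr s with j |-> Some x] (xbit s) (abit s) (output s))
  | BAOutput b =>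
      if output s is None then
        LState (accepted s) (varr s) (xarr s) (xbit s) (abit s)
          (Some (decision vdef v tie s b))
      else s
  end.

(** ** Runs *)

(* A schedule says, for each time, which party is handed which event (None if
   nothing happens).  Corrupted parties act only through the values that honest
   parties accept from them and through the outcome of the binary A-BA; the
   state attached to a corrupted party is meaningless. *)
Definition schedule := nat -> option ('I_n * input_event n V).

(* The local state of party [i] just before the event of time [k]. *)
Fixpoint state (t : nat) (vdef : V) (inp tie : 'I_n -> V) (ev : schedule)
    (k : nat) (i : 'I_n) : lstate n V :=
  if k is k'.+1 then
    let s := state t vdef inp tie ev k' i in
    if ev k' is Some (i', e) then
      if i' == i then handle t vdef (inp i) (tie i) s e else s
    else s
  else init_state t (inp i).

(* A complete run (eventual delivery is part of [ACast]) compatible with the ideal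
   A-Casts and with some binary A-BA protocol. *)
Definition valid_run (t : nat) (vdef : V) (corrupt : {set 'I_n})
    (inp tie : 'I_n -> V) (ev : schedule) : Prop :=
  let honest := ~: corrupt in
  let st := state t vdef inp tie ev in
  [/\ (* first A-Cast: the input is sent at the start *)
      ACast honest (fun j _ v => inp j = v)
        (fun i j k v => ev k = Some (i, AcceptValue j v)),
      (* second A-Cast: (v_j, x_j) is sent once x_j is computed *)
      ACast honest
        (fun j k (p : V * bool) => inp j = p.1 /\ xbit (st k j) = Some p.2)
        (fun i j k p => ev k = Some (i, AcceptPair j p.1 p.2)),
      ABA honest (fun i a => exists k, abit (st k i) = Some a)
        (fun i b => exists k, ev k = Some (i, BAOutput b))
      (* A party gets an output [b] of the binary A-BA only after it has given
         its own input, when at most [t] parties have not yet participated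
         (corrupted ones may participate at any time), and when [b] is the
         input of an honest party that has participated: otherwise the inputs
         still to come could all be [~~ b], contradicting validity. *)
    & forall i k b, i \in honest -> ev k = Some (i, BAOutput b) ->
        [/\ abit (st k i) != None,
            n - t <= #|corrupt :|: [set j in honest | abit (st k j) != None]|
          & exists2 j, j \in honest & abit (st k j) = Some b]].

End Code.

(** ** Security *)

(* All static choices of at most [t] corrupted parties, all inputs, all
   behaviours of the corrupted parties and all schedulings. *)
Definition atc_securely_implements_ABA (n t : nat) (V : eqType) (vdef : V) :
    Prop :=
  forall (corrupt : {set 'I_n}) (inp tie : 'I_n -> V) (ev : schedule),
    #|corrupt| <= t ->
    valid_run t vdef corrupt inp tie ev ->
    ABA (~: corrupt) (fun i v => inp i = v)
      (fun i v => exists k, output (state t vdef inp tie ev k i) = Some v).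

(* Main.v *)
(** If n <= 3t, let t parties have input v and the others w: among the first
    n - t values each party sees at most t values different from its own, so all
    are content, the binary agreement returns 0, and all output their inputs.

    If 3t < n <= 5t, the adversary makes 2t honest parties perplexed: t of them
    with input w, and t of them with input v that are shown the 2t values w of
    the former and of the corrupted parties first.  The n - 3t other honest
    parties are content with v.  One of these is shown only t of the perplexed
    parties and is not alert, which allows the binary agreement to return 0;
    this party outputs v.  A perplexed party with input w is shown the t
    corrupted parties, claiming to be content with w, and at most n - 4t <= t
    content parties with v: its majority is w, or is not defined. *)

Require Import Defs.
From mathcomp Require Import all_boot.
From mathcomp Require Import zify.

Set Implicit Arguments.
Unset Strict Implicit.
Unset Printing Implicit Defensive.

(** * Effect of one event on the local state of a party *)

Section Handling.
Context {n : nat} {V : eqType}.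
Variables (t : nat) (vdef v tie : V).
Implicit Types (s : lstate n V) (e : input_event n V).

(** Invariant that turns counts of delivered messages into computed bits. *)
Definition quiescent s : Prop :=
  (n - t <= #|accepted s| -> xbit s != None) /\
  (xbit s != None -> n - t <= #|[set j | xarr s j != None]| -> abit s != None).

Lemma accepted_progress s : accepted (progress t v s) = accepted s.
Proof. by rewrite /progress /step5 /step3; do 2!case: ifP. Qed.

Lemma varr_progress s : varr (progress t v s) = varr s.
Proof. by rewrite /progress /step5 /step3; do 2!case: ifP. Qed.

Lemma xarr_progress s : xarr (progress t v s) = xarr s.
Proof. by rewrite /progress /step5 /step3; do 2!case: ifP. Qed.

Lemma output_progress s : output (progress t v s) = output s.
Proof. by rewrite /progress /step5 /step3; do 2!case: ifP. Qed.

Lemma xbit_progress s : xbit (progress t v s) = xbit (step3 t v s).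
Proof. by rewrite /progress /step5; case: ifP. Qed.

Lemma xarr_step3 s : xarr (step3 t v s) = xarr s.
Proof. by rewrite /step3; case: ifP. Qed.

Lemma abit_step3 s : abit (step3 t v s) = abit s.
Proof. by rewrite /step3; case: ifP. Qed.

(** A single pass suffices, since [step5] changes nothing that the test of [step3] reads. *)
Lemma quiescent_progress s : quiescent (progress t v s).
Proof.
split; first by rewrite accepted_progress xbit_progress /step3 => ->;
  rewrite andbT; case: ifP => //= ->.
rewrite xbit_progress xarr_progress /progress /step5 xarr_step3 => -> -> /=.
by case: ifP => //=; rewrite andbT => ->.
Qed.

Lemma quiescent_handle s e : quiescent s -> quiescent (handle t vdef v tie s e).
Proof.
case: e => [j w|j w x|b] qs; try exact: quiescent_progress.
by rewrite /handle; case: (output s).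
Qed.

Lemma xbit_progress_Some s x : xbit s = Some x -> xbit (progress t v s) = Some x.
Proof. by rewrite xbit_progress /step3 => xs; rewrite {1}xs. Qed.

Lemma abit_progress_Some s a : abit s = Some a -> abit (progress t v s) = Some a.
Proof.
by move=> ea; rewrite /progress /step5 abit_step3 ea /= andbF abit_step3.
Qed.

Lemma xbit_handle_Some s e x :
  xbit s = Some x -> xbit (handle t vdef v tie s e) = Some x.
Proof.
case: e => [j w|j w y|b] xs; try exact: xbit_progress_Some.
by rewrite /handle; case: (output s).
Qed.

Lemma abit_handle_Some s e a :
  abit s = Some a -> abit (handle t vdef v tie s e) = Some a.
Proof.
case: e => [j w|j w y|b] xs; try exact: abit_progress_Some.
by rewrite /handle; case: (output s).
Qed.

Lemma xbit_handle_None s e x (s' := handle t vdef v tie s e) :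
  xbit s = None -> xbit s' = Some x ->
  n - t <= #|accepted s'| /\
  x = (t < #|[set j | (varr s' j != None) && (varr s' j != Some v)]|).
Proof.
rewrite {}/s'; case: e => [j w|j w y|b] /= xs;
  last by case: (output s) => [?|] /=; rewrite xs.
all: rewrite accepted_progress varr_progress xbit_progress /step3 /= xs /=.
all: by case: ifP => //= _ [<-].
Qed.

Lemma abit_handle_None s e a (s' := handle t vdef v tie s e) :
  abit s = None -> abit s' = Some a ->
  a = (t < #|[set j | xarr s' j == Some true]|).
Proof.
rewrite {}/s'; case: e => [j w|j w y|b] /= xs;
  last by case: (output s) => [?|] /=; rewrite xs.
all: rewrite xarr_progress /progress /step5 xarr_step3 /=.
all: by case: ifP => /= _; rewrite ?abit_step3 /= ?xs // => -[<-].
Qed.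

End Handling.

(** * The attack schedule and the arrays it produces *)

(* [S i] and [T i] are the senders whose first and second messages are delivered
   to [i] before the binary agreement, and [xb j] is the bit A-Cast by [j].
   Corrupted parties also send [inp j] and [(inp j, xb j)]. *)
Section Attack.

Context {n : nat} {V : eqType}.
Variables (t : nat) (vdef : V) (corrupt : {set 'I_n}) (inp tie : 'I_n -> V).
Variables (S T : 'I_n -> {set 'I_n}) (xb : 'I_n -> bool).

Local Notation code := (option ('I_n * bool)).

(* [Some (j, false)] stands for the first message of [j], [Some (j, true)] for
   its second one, and [None] for the outcome 0 of the binary agreement. *)
Definition event_of (c : code) : input_event n V :=
  match c with
  | Some (j, false) => AcceptValue j (inp j)
  | Some (j, true) => AcceptPair j (inp j) (xb j)
  | None => BAOutput false
  end.

Definition value_phase : seq ('I_n * code) :=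
  enum [pred p : 'I_n * code | if p.2 is Some (j, false) then j \in S p.1 else false].
Definition pair_phase : seq ('I_n * code) :=
  enum [pred p : 'I_n * code | if p.2 is Some (j, true) then j \in T p.1 else false].
Definition ba_phase : seq ('I_n * code) :=
  enum [pred p : 'I_n * code | p.2 == None].
(* Delivers all messages, including again those already delivered, which [ACast]
   allows. *)
Definition late_phase : seq ('I_n * code) :=
  enum [pred p : 'I_n * code | p.2 != None].
Definition attack_events : seq ('I_n * code) :=
  value_phase ++ pair_phase ++ ba_phase ++ late_phase.

Definition attack_schedule : @schedule n V := fun k =>
  omap (fun p : 'I_n * code => (p.1, event_of p.2)) (onth attack_events k).

Local Notation st := (state t vdef inp tie attack_schedule).
Local Notation k1 := (size value_phase).
Local Notation k2 := (size value_phase + size pair_phase).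
Local Notation k3 := (size value_phase + size pair_phase + size ba_phase).

(** Time is the position in [attack_events]. Being a set, [seen] is insensitive to the redeliveries
    of [late_phase]. *)
Definition seen (k : nat) (i : 'I_n) (b : bool) : {set 'I_n} :=
  [set j | (i, Some (j, b)) \in take k attack_events].

Lemma state_ind (P : nat -> 'I_n -> lstate n V -> Prop) :
  (forall i, P 0 i (init_state t (inp i))) ->
  (forall k i, P k i (st k i) ->
     (forall c, onth attack_events k <> Some (i, c)) -> P k.+1 i (st k i)) ->
  (forall k i c, P k i (st k i) -> onth attack_events k = Some (i, c) ->
     P k.+1 i (handle t vdef (inp i) (tie i) (st k i) (event_of c))) ->
  forall k i, P k i (st k i).
Proof.
move=> P0 Pskip Phandle; elim=> [|k IHk] i //=.
rewrite {1}/attack_schedule; case E: (onth _ k) => [[i' c]|] /=; last first.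
  by apply: Pskip => // c; rewrite E.
case: eqP => [ii'|ne]; first by apply: Phandle; rewrite // E ii'.
by apply: Pskip => // c'; rewrite E => -[/ne].
Qed.

Lemma mem_takeS (A : eqType) (s : seq A) k x :
  (x \in take k.+1 s) = (x \in take k s) || (onth s k == Some x).
Proof.
elim: s k => [|y s IHs] [|k] //=; first by rewrite take0 inE eq_sym.
by rewrite !inE IHs orbA.
Qed.

Lemma seen_init i b : seen 0 i b = set0.
Proof. by apply/setP=> j; rewrite !inE take0. Qed.

Lemma seen_skip k i b :
  (forall c, onth attack_events k <> Some (i, c)) -> seen k.+1 i b = seen k i b.
Proof.
by move=> no; apply/setP=> j; rewrite !inE mem_takeS (introF eqP (no _)) orbF.
Qed.

(** Order and repetition of deliveries do not matter, because both messages of [j] carry the same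
    value [inp j]. *)
Lemma state_arrays k i :
  [/\ accepted (st k i) = seen k i false,
      varr (st k i) =1
        fun j => if j \in seen k i false :|: seen k i true then Some (inp j) else None
    & xarr (st k i) =1 fun j => if j \in seen k i true then Some (xb j) else None].
Proof.
elim/state_ind: k i / _ => [i|k i IH no|k i c [IHa IHv IHx] ev].
- split=> [|j|j]; rewrite /init_state ?(accepted_progress, varr_progress, xarr_progress);
  by rewrite !seen_init ?setU0 ?inE.
- by rewrite !seen_skip.
have seenS b : seen k.+1 i b =
    if c is Some (j, b') then (if b' == b then j |: seen k i b else seen k i b)
    else seen k i b.
  apply/setP=> j; rewrite inE mem_takeS ev.
  case: c {ev} => [[j' b']|]; last by rewrite inE; case: eqP => // _; rewrite orbF.
  have ->: (Some (i, Some (j', b')) == Some (i, Some (j, b)) :> option ('I_n * code))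
      = (j' == j) && (b' == b).
    by apply/eqP/andP => [[-> ->]|[/eqP-> /eqP->]].
  by case: (b' == b); rewrite !inE ?andbT ?andbF ?orbF // orbC eq_sym.
case: c ev seenS => [[j' [] ]|] ev seenS; rewrite !seenS /=.
- split=> [|j|j]; rewrite ?(accepted_progress, varr_progress, xarr_progress) //=.
  (* If the entry of [j'] is already recorded, [j'] was seen before, so keeping the array fits the
     enlarged set. *)
  + have := IHv j'; rewrite !inE; case: (varr _ j') => [u|] /=.
      case: ifP => // H _; rewrite IHv !inE; case: eqP => [->|//].
      by rewrite H orbT.
    move=> _; case: eqP => [->|_]; first by rewrite /= orbT.
    by rewrite IHv !inE.
  + by rewrite IHx !inE; case: eqP => [->|].
- split=> [|j|j]; rewrite ?(accepted_progress, varr_progress, xarr_progress) //=.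
    by rewrite IHa.
  by rewrite !inE; case: eqP => [->|_] //=; rewrite IHv !inE.
by case: (output _).
Qed.

Lemma state_quiescent k i : quiescent t (st k i).
Proof.
elim/state_ind: k i / _ => [i|//|k i c IH _]; first exact: quiescent_progress.
exact: quiescent_handle.
Qed.

Lemma ev_attackE k i e : attack_schedule k = Some (i, e) ->
  exists2 c, onth attack_events k = Some (i, c) & e = event_of c.
Proof.
rewrite /attack_schedule; case: (onth _ k) => [[i' c]|] //= [<- <-].
by exists c.
Qed.

Lemma seen_subset k k' i b : k <= k' -> seen k i b \subset seen k' i b.
Proof.
move=> le_kk'; apply/subsetP=> j; rewrite !inE.
rewrite -(subnKC le_kk') takeD mem_cat; by move=> ->.
Qed.

Lemma value_phase_end : take k1 attack_events = value_phase.
Proof. exact: take_size_cat. Qed.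

Lemma pair_phase_end : take k2 attack_events = value_phase ++ pair_phase.
Proof. by rewrite /attack_events catA -size_cat take_size_cat. Qed.

Lemma ba_phase_end :
  take k3 attack_events = value_phase ++ pair_phase ++ ba_phase.
Proof. by rewrite /attack_events !catA -!size_cat take_size_cat. Qed.

Lemma seen_value_phase i : seen k1 i false = S i.
Proof. by apply/setP=> j; rewrite inE value_phase_end mem_enum. Qed.

Lemma seen_value_phase_pair i : seen k1 i true = set0.
Proof. by apply/setP=> j; rewrite !inE value_phase_end mem_enum. Qed.

Lemma seen_pair_phase i : seen k2 i true = T i.
Proof.
by apply/setP=> j; rewrite inE pair_phase_end mem_cat !mem_enum.
Qed.

Lemma seen_ba_phase i : seen k3 i true = T i.
Proof.
by apply/setP=> j; rewrite inE ba_phase_end !mem_cat !mem_enum /= orbF.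
Qed.

Lemma attack_event_take k p :
  onth attack_events k = Some p -> p \in take k.+1 attack_events.
Proof. by move=> kp; rewrite mem_takeS kp eqxx orbT. Qed.

Lemma pair_event_time k i j :
  onth attack_events k = Some (i, Some (j, true)) -> k1 <= k.
Proof.
move/attack_event_take => kp; rewrite leqNgt; apply/negP=> lt_k.
have := subsetP (seen_subset i true lt_k) j.
by rewrite seen_value_phase_pair !inE => /(_ kp).
Qed.

Lemma ba_event_time k i : onth attack_events k = Some (i, None) -> k2 <= k < k3.
Proof.
move=> kp; apply/andP; split.
  rewrite leqNgt; apply/negP=> lt_k; have := attack_event_take kp.
  have: take k.+1 attack_events = take k.+1 (take k2 attack_events).
    by rewrite take_takel.
  by move=> -> /mem_take; rewrite pair_phase_end mem_cat !mem_enum.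
rewrite ltnNge; apply/negP=> le_k; move: kp.
rewrite /attack_events !catA onth_cat !size_cat ltnNge le_k /=.
move=> kp; have: (i, None) \in late_phase by apply/onthP; exists (k - k3).
by rewrite mem_enum.
Qed.

Lemma attack_event_exists p : p \in attack_events ->
  exists k, onth attack_events k = Some p.
Proof. by move/onthP. Qed.

Lemma ba_event_exists i : exists k, onth attack_events k = Some (i, None).
Proof. by apply: attack_event_exists; rewrite !mem_cat !mem_enum. Qed.

Lemma message_event_exists i jb :
  exists k, onth attack_events k = Some (i, Some jb).
Proof. by apply: attack_event_exists; rewrite !mem_cat !mem_enum /= !orbT. Qed.

(** * The bits computed during the attack *)

Hypothesis card_S : forall i, #|S i| = n - t.
Hypothesis card_T : forall i, n - t <= #|T i|.

Lemma xbit_computed k i : k1 <= k -> xbit (st k i) != None.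
Proof.
move=> le_k; have [+ _] := state_quiescent k i; apply.
have [-> _ _] := state_arrays k i.
by rewrite -(card_S i) -(seen_value_phase i) subset_leq_card ?seen_subset.
Qed.

Lemma abit_computed k i : k2 <= k -> abit (st k i) != None.
Proof.
move=> le_k; have [_ +] := state_quiescent k i; apply.
  by apply: xbit_computed; apply: leq_trans le_k; apply: leq_addr.
have [_ _ xE] := state_arrays k i.
apply: leq_trans (card_T i) _; apply: subset_leq_card.
rewrite -(seen_pair_phase i); apply: subset_trans (seen_subset i true le_k) _.
by apply/subsetP=> j jk; rewrite inE xE jk.
Qed.

Hypothesis xbE : forall i, i \in ~: corrupt ->
  xb i = (t < #|[set j in S i | inp j != inp i]|).

Lemma state_step k i : st k.+1 i = st k i \/
  exists2 c, onth attack_events k = Some (i, c)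
    & st k.+1 i = handle t vdef (inp i) (tie i) (st k i) (event_of c).
Proof.
rewrite /= /attack_schedule; case: onth => [[i' c]|] /=; last by left.
by case: eqP => [->|_]; [right; exists c|left].
Qed.

(** The bit is computed when at least [n - t] senders have been seen. They all lie in [S i], which
    has exactly that size, and no pair has arrived yet, so the recorded entries are those of
    [S i]. *)
Lemma xbit_stateE k i :
  i \in ~: corrupt -> xbit (st k i) \in [:: None; Some (xb i)].
Proof.
move=> hi; elim: k => [|k]; rewrite !inE.
  (* The bit is computed already at the start if [n - t = 0]; then [S i] is empty and both counts
     are 0. *)
  rewrite /= /init_state xbit_progress /step3 /= cards0; case: ifP => //= le_nt.
  apply/eqP; congr Some; rewrite xbE //.
  have -> : S i = set0 by apply/eqP; rewrite -cards_eq0 card_S -leqn0.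
  rewrite (_ : [set _ in _ | _] = set0) ?cards0 //.
  by apply/setP=> j; rewrite !inE.
case E: (xbit (st k i)) => [x|] IH.
  by case: (state_step k i) => [|[c _]] ->; rewrite ?(xbit_handle_Some _ _ _ _ _ E) ?E.
have lt_k : k < k1.
  by rewrite ltnNge; apply/negP=> /(xbit_computed i); rewrite E.
case E': (xbit (st k.+1 i)) => [x|] //=; apply/eqP; congr Some; rewrite xbE //.
case: (state_step k i) => [st_eq|[c _ st_eq]]; first by rewrite st_eq E in E'.
have := E'; rewrite st_eq => /(xbit_handle_None E) []; rewrite -st_eq.
have [-> vE _] := state_arrays k.+1 i => le_nt ->.
have seenS : seen k.+1 i false = S i.
  apply/eqP; rewrite eqEcard card_S le_nt andbT -(seen_value_phase i).
  exact: seen_subset.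
have seen0 : seen k.+1 i true = set0.
  by apply/eqP; rewrite -subset0 -(seen_value_phase_pair i) seen_subset.
congr (_ < _); apply: eq_card => j.
by rewrite !inE vE seenS seen0 setU0; case: ifP.
Qed.

Lemma xbit_stateP k i : i \in ~: corrupt -> k1 <= k -> xbit (st k i) = Some (xb i).
Proof.
move=> hi /(xbit_computed i) xk; have := xbit_stateE k hi.
by rewrite !inE (negPf xk) => /eqP.
Qed.

(** The bit may be computed before all of [T q] has arrived, but the perplexed senders seen by then
    are among those of [T q]. *)
Lemma abit_calm k q : #|[set j in T q | xb j]| <= t ->
  abit (st k q) \in [:: None; Some false].
Proof.
move=> few; elim: k => [|k]; rewrite !inE.
  rewrite /= /init_state /progress /step5; case: ifP => //= _.
    rewrite xarr_step3 /=; apply/eqP; congr Some.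
    apply/negbTE; rewrite -leqNgt (_ : [set _ | _] = set0) ?cards0 //.
  by rewrite abit_step3.
case E: (abit (st k q)) => [x|] IH.
  by case: (state_step k q) => [|[c _]] ->; rewrite ?(abit_handle_Some _ _ _ _ _ E) ?E.
have lt_k : k < k2.
  by rewrite ltnNge; apply/negP=> /(abit_computed q); rewrite E.
case E': (abit (st k.+1 q)) => [x|] //=; apply/eqP; congr Some.
case: (state_step k q) => [st_eq|[c _ st_eq]]; first by rewrite st_eq E in E'.
have := E'; rewrite st_eq => /(abit_handle_None E); rewrite -st_eq => ->.
have [_ _ xE] := state_arrays k.+1 q.
apply/negbTE; rewrite -leqNgt; apply: leq_trans few; apply: subset_leq_card.
apply/subsetP=> j; rewrite !inE xE; case: ifP => // jk /eqP[->].
by rewrite andbT -(seen_pair_phase q) (subsetP (seen_subset q true lt_k)).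
Qed.

(** * Outputs, validity of the run, and disagreement *)

(* The value that party [i] is bound to output from what it has seen when the
   binary agreement returns 0. *)
Definition forced (i : 'I_n) (u : V) : Prop :=
  if xb i then
    tie i = u /\
    forall j, j \in T i -> ~~ xb j -> inp j != u ->
      2 * #|[set k in T i | ~~ xb k & inp k == inp j]|
        <= #|[set k in T i | ~~ xb k]|
  else inp i = u.

Lemma output_forced_stateE k i u : i \in ~: corrupt -> forced i u ->
  output (st k i) \in [:: None; Some u].
Proof.
move=> hi fu; elim: k => [|k IH]; first by rewrite /= output_progress.
case: (state_step k i) => [->|[c ev ->]] //.
case: c ev => [[j [] ]|] ev /=; rewrite ?output_progress //=.
case E: (output (st k i)) => [o|]; first exact: IH.
have /andP[le_k gt_k] := ba_event_time ev.
rewrite !inE /=; apply/eqP; congr Some.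
have le1 : k1 <= k by apply: leq_trans le_k; apply: leq_addr.
rewrite xbit_stateP //; move: fu; rewrite /forced.
case: (xb i) => //= -[tu maj]; rewrite /majority.
(* [ba_phase] delivers no message, so throughout it party [i] has seen the pairs of [T i] and no
   others. *)
have seenT : seen k i true = T i.
  apply/eqP; rewrite eqEsubset -{1}(seen_ba_phase i) -(seen_pair_phase i).
  by rewrite !seen_subset // ltnW.
have [_ vE xE] := state_arrays k i.
have vT j : j \in T i -> varr (st k i) j = Some (inp j).
  by rewrite -seenT => jT; rewrite vE inE jT orbT.
have CE : content_entries (st k i) = [set k in T i | ~~ xb k].
  apply/setP=> j; rewrite !inE xE seenT.
  case: ifP => //= jT; rewrite vT // andbT.
  by case: (xb j).
rewrite CE; case: pickP => // j; rewrite inE => /andP[/andP[jT xj] lt_j].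
rewrite vT //=; apply: contraTeq lt_j => ne; rewrite -leqNgt.
apply: leq_trans (maj j jT xj ne); rewrite leq_mul2l /=.
apply: subset_leq_card; apply/subsetP=> l; rewrite !inE => /andP[/andP[lT xl]].
by rewrite lT xl !vT.
Qed.

Lemma forced_output i u : i \in ~: corrupt -> forced i u ->
  exists k, output (st k i) = Some u.
Proof.
move=> hi fu; have [k ev] := ba_event_exists i; exists k.+1.
have := output_forced_stateE k.+1 hi fu; rewrite !inE => /orP[|/eqP //].
rewrite /= /attack_schedule ev /= eqxx.
by case E: (output (st k i)) => [w|] /=; rewrite ?E.
Qed.

(** One honest party [q] that is not alert justifies the outcome 0: validity cannot impose 1, and
    [q] is the participant with input 0. *)
Lemma attack_valid q : q \in ~: corrupt -> #|[set j in T q | xb j]| <= t ->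
  valid_run t vdef corrupt inp tie attack_schedule.
Proof.
move=> hq few; split.
- split.
  + move=> i i' j k k' m m' _ _.
    move=> /ev_attackE [[[j1 []]|] _ //= [-> ->]].
    by move=> /ev_attackE [[[j2 []]|] _ //= [-> ->]].
  + move=> i i' j k m _ _ /ev_attackE [[[j1 []]|] _ //= [-> ->]].
    have [k' ev] := message_event_exists i' (j1, false).
    by exists k'; rewrite /attack_schedule ev.
  + move=> i j k m _ _ <-; have [k' ev] := message_event_exists i (j, false).
    by exists k'; rewrite /attack_schedule ev.
  + by move=> i j k m _ _ /ev_attackE [[[j1 []]|] _ //= [-> ->]].
- split.
  + move=> i i' j k k' [m x] [m' x'] _ _ /=.
    move=> /ev_attackE [[[j1 []]|] _ //= [-> -> ->]].
    by move=> /ev_attackE [[[j2 []]|] _ //= [-> -> ->]].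
  + move=> i i' j k [m x] _ _ /= /ev_attackE [[[j1 []]|] _ //= [-> -> ->]].
    have [k' ev] := message_event_exists i' (j1, true).
    by exists k'; rewrite /attack_schedule ev.
  + move=> i j k [m x] _ hj /= [<- xk].
    have [k' ev] := message_event_exists i (j, true).
    exists k'; rewrite /attack_schedule ev /=.
    by have := xbit_stateE k hj; rewrite xk !inE /= => /eqP[->].
  + move=> i j k [m x] _ hj /= /ev_attackE [[[j1 []]|] ev //= [ej -> ->]].
    rewrite -ej in ev *; split=> //; apply: xbit_stateP => //.
    exact: pair_event_time ev.
- split.
    move=> i j b b' _ _ [k /ev_attackE [[[j1 []]|] _ //= [->]]].
    by move=> [k' /ev_attackE [[[j2 []]|] _ //= [->]]].
  move=> b all_b i _; have [k aq] := all_b q hq.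
  have := abit_calm k few; rewrite aq !inE /= => /eqP[->].
  have [k' ev] := ba_event_exists i.
  by exists k'; rewrite /attack_schedule ev.
move=> i k b hi /ev_attackE [[[j1 []]|] ev //= [->]].
have /andP[le_k _] := ba_event_time ev.
split; first exact: abit_computed.
  rewrite (_ : _ :|: _ = setT) ?cardsT ?card_ord ?leq_subr //.
  by apply/setP=> j; rewrite !inE abit_computed // andbT orbN.
exists q => //; have := abit_calm k few.
by rewrite !inE (negPf (abit_computed q le_k)) => /eqP.
Qed.

Lemma attack_insecure p q u w : #|corrupt| <= t ->
  p \in ~: corrupt -> q \in ~: corrupt -> #|[set j in T q | xb j]| <= t ->
  forced p u -> forced q w -> u != w ->
  ~ atc_securely_implements_ABA n t vdef.
Proof.
move=> le_t hp hq few fp fq /eqP ne sec.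
have [agree _] := sec _ _ _ _ le_t (attack_valid hq few).
by apply: ne; apply: (agree p q u w hp hq); apply: forced_output.
Qed.

End Attack.

(** * The concrete attacks in the two ranges of [n] *)

Lemma card_ord_interval n a b : b <= n -> #|[set j : 'I_n | a <= j < b]| = b - a.
Proof.
move=> le_bn; rewrite -sum1dep_card -(big_mkord (fun j => a <= j < b) (fun=> 1)).
rewrite -[RHS]muln1 -sum_nat_const_nat (@big_nat_widenl _ _ _ a 0) //.
by rewrite (big_nat_widen _ _ _ _ _ le_bn); apply: eq_bigl.
Qed.

(** Nobody is corrupted: delays alone keep every party content. *)
Lemma insecure_le3 (V : eqType) (n t : nat) (vdef v w : V) :
  v != w -> 1 < n -> 0 < t -> n <= 3 * t ->
  ~ atc_securely_implements_ABA n t vdef.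
Proof.
move=> ne n1 t0 nt; have n0 : 0 < n by exact: ltnW.
(* The minimum leaves the last party with input [w] even when [t >= n]. *)
pose inp (j : 'I_n) := if j < minn t n.-1 then v else w.
have lt_n : n.-1 < n by rewrite prednK.
have Scard : #|[set j : 'I_n | 0 <= j < n - t]| = n - t.
  by rewrite card_ord_interval ?subn0 ?leq_subr.
apply: (@attack_insecure n V t vdef set0 inp inp
  (fun=> [set j : 'I_n | 0 <= j < n - t]) (fun=> setT) (fun=> false) _ _ _
  (Ordinal n0) (Ordinal lt_n) v w); rewrite /forced ?cards0 ?inE //=.
- by move=> i; rewrite cardsT card_ord leq_subr.
- move=> i _; apply/esym/negbTE; rewrite -leqNgt.
  case: (ltnP i (minn t n.-1)) => lt_i.
    (* The values [w] among the first [n - t] number at most [n - 2t <= t]. *)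
    apply: leq_trans (_ : (n - t) - t <= _); last by lia.
    rewrite -[X in _ <= X](@card_ord_interval n) ?leq_subr //.
    apply: subset_leq_card; apply/subsetP=> j.
    rewrite !inE /inp lt_i; case: ifP; rewrite ?eqxx ?andbF //; lia.
  apply: leq_trans (_ : minn t n.-1 - 0 <= _); last by lia.
  rewrite -[X in _ <= X](@card_ord_interval n); last by lia.
  apply: subset_leq_card; apply/subsetP=> j.
  by rewrite !inE /inp [i < _]ltnNge lt_i; case: ifP; rewrite ?eqxx ?andbF.
- by rewrite (_ : [set _ in _ | _] = set0) ?cards0 //; apply/setP=> j; rewrite !inE.
- by rewrite /inp /=; case: ifP => //; lia.
- by rewrite /inp /=; case: ifP => //; lia.
Qed.

(* Party [j] is corrupted for [j < t], and honest with input [w] for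
   [t <= j < 2t], so that [w] is the input of 2t parties; the honest parties of
   [2t <= j < 3t] have input [v] but see [w] 2t times.  The perplexed parties
   are those of [t <= j < 3t], and the corrupted ones claim to be content. *)
Lemma insecure_le5 (V : eqType) (n t : nat) (vdef v w : V) :
  v != w -> 3 * t < n <= 5 * t -> ~ atc_securely_implements_ABA n t vdef.
Proof.
move=> ne /andP[n3t n5t].
have lt_p : t < n by lia.
have lt_q : n.-1 < n by lia.
pose inp (j : 'I_n) := if j < 2 * t then w else v.
pose xb (j : 'I_n) := t <= j < 3 * t.
(* Outside [[2t, 3t)] the corrupted parties are skipped: the [t] values [w] left do not perplex a
   party with [v], while the [n - 2t > t] values [v] perplex one with [w]. *)
pose S (i : 'I_n) : {set 'I_n} := if 2 * t <= i < 3 * t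
  then [set j : 'I_n | 0 <= j < n - t] else [set j : 'I_n | t <= j < n].
(* From [3t] on, the [t] perplexed parties with input [v] are hidden, so only [t] perplexed ones are
   seen. *)
pose T (i : 'I_n) : {set 'I_n} := if i < 3 * t
  then [set j : 'I_n | 0 <= j < n - t]
  else ~: [set j : 'I_n | 2 * t <= j < 3 * t].
have inp_w j : (inp j == w) = (j < 2 * t).
  by rewrite /inp; case: ifP; rewrite ?eqxx // (negPf ne).
have inp_v j : (inp j == v) = (2 * t <= j).
  by rewrite /inp [2 * t <= _]leqNgt; case: ifP; rewrite ?eqxx // eq_sym (negPf ne).
have le_card (A : {set 'I_n}) (a b : nat) : b <= n ->
    (forall j : 'I_n, a <= j < b -> j \in A) -> b - a <= #|A|.
  move=> le_bn sub; rewrite -(@card_ord_interval n a b) //.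
  by apply/subset_leq_card/subsetP=> j; rewrite inE; apply: sub.
have card_le (A : {set 'I_n}) (a b : nat) : b <= n ->
    (forall j : 'I_n, j \in A -> a <= j < b) -> #|A| <= b - a.
  move=> le_bn sub; rewrite -(@card_ord_interval n a b) //.
  by apply/subset_leq_card/subsetP=> j; rewrite inE; apply: sub.
(* Party [t] is perplexed with [w], the last party content with [v]. The tie value [w] settles
   [n = 5t], where the content entries seen by party [t] split evenly. *)
apply: (@attack_insecure n V t vdef [set j : 'I_n | 0 <= j < t] inp (fun=> w)
  S T xb _ _ _ (Ordinal lt_p) (Ordinal lt_q) w v); last by rewrite eq_sym.
- by move=> i; rewrite /S; case: ifP => _; rewrite card_ord_interval; lia.
- move=> i; rewrite /T; case: ifP => _; first by rewrite card_ord_interval; lia.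
  by rewrite cardsCs setCK card_ord card_ord_interval; lia.
- move=> i; rewrite !inE -leqNgt /= => le_ti; rewrite /xb /S le_ti /=.
  case: (ltnP i (3 * t)) => [lt_i|le_i]; rewrite ?andbF ?andbT; apply/esym.
    case: (leqP (2 * t) i) => i2t.
      have -> : inp i = v by apply/eqP; rewrite inp_v.
      apply: leq_trans (_ : 2 * t - 0 <= _); first by lia.
      apply: le_card; first by lia.
      by move=> j jt; rewrite !inE inp_v; lia.
    have -> : inp i = w by apply/eqP; rewrite inp_w.
    apply: leq_trans (_ : n - 2 * t <= _); first by lia.
    apply: le_card => // j jt; rewrite !inE inp_w; lia.
  have -> : inp i = v by apply/eqP; rewrite inp_v; lia.
  apply/negbTE; rewrite -leqNgt; apply: leq_trans (_ : 2 * t - t <= _); last by lia.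
  apply: card_le; first by lia.
  by move=> j; rewrite !inE inp_v; lia.
- by rewrite card_ord_interval; lia.
- by rewrite !inE /=; lia.
- by rewrite !inE /=; lia.
- rewrite /T ifN /=; last by lia.
  apply: leq_trans (_ : 2 * t - t <= _); last by lia.
  by apply: card_le; [lia|move=> j; rewrite !inE /xb; lia].
- rewrite /forced /xb ifT /=; last by lia.
  split=> // j; rewrite /T ifT /=; last by lia.
  rewrite inE inp_w => jT xj jw.
  (* Content entries other than [w] come from [[3t, n - t)]. The [t] corrupted entries are at least
     as many, as [n - 4t <= t], so there is no strict majority against [w]. *)
  apply: leq_trans (_ : 2 * ((n - t) - 3 * t) <= _).
    rewrite leq_mul2l /=; apply: card_le; first by lia.
    move=> k; rewrite !inE => /and3P[kT xk /eqP kj].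
    have := inp_w k; rewrite kj inp_w; lia.
  set K := [set k in _ | _].
  have -> : K = [set k : 'I_n | 0 <= k < t] :|: [set k : 'I_n | 3 * t <= k < n - t].
    by apply/setP=> k; rewrite !inE; lia.
  rewrite cardsU (_ : _ :&: _ = set0); last by apply/setP=> k; rewrite !inE; lia.
  by rewrite cards0 !card_ord_interval; lia.
by rewrite /forced /xb ifF /=; [apply/eqP; rewrite inp_v /=|]; lia.
Qed.

Theorem proposition10 (V : eqType) (n t : nat) (vdef : V) :
  (exists v w : V, v != w) ->
  1 < n ->
  n <= 5 * t ->
  ~ atc_securely_implements_ABA n t vdef.
Proof.
move=> [v [w ne]] n1 nt; case: (leqP n (3 * t)) => n3t.
  by apply: insecure_le3 ne _ _ _; lia.
by apply: insecure_le5 ne _; lia.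
Qed.
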